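(* There is a universal constant $K>0$ such that the following holds. Let $F$ be a non-abelian free group of finite rank, let $\varphi_\alpha\in\ell^1_{Ind}$, let $\phi_\lambda$ be a Rolli quasimorphism of $F$, and let $w\in F$ be any non-trivial word. 1. $[\delta^1\varphi_\alpha]\smile[\delta^1H_w]=0\in H^4_b(F)$, with a primitive of $\delta^1\varphi_\alpha\smile\delta^1H_w$ of norm at most $K\,SInd_\alpha\cdot D(H_w)\,|w|$. 2. $[\delta^1\phi_\lambda]\smile[\delta^1H_w]=0\in H^4_b(F)$, with a primitive of $\delta^1\phi_\lambda\smile\delta^1H_w$ of norm at most $K\,\|\lambda\|_\infty\cdot D(H_w)\,|w|$.
   Context: Bounded cohomology. $C^n_b(F)$ is the space of bounded functions $F^n\to\mathbb{R}$ with the sup norm ($C^0_b=\mathbb{R}$). The coboundary is $\delta^n f(g_1,\dots,g_{n+1})=f(g_2,\dots,g_{n+1})+\sum_{i=1}^n(-1)^i f(g_1,\dots,g_ig_{i+1},\dots,g_{n+1})+(-1)^{n+1}f(g_1,\dots,g_n)$ ($\delta^0=0$), defined also on unbounded functions; $H^n_b(F)=\ker(\delta^n|_{C^n_b})/\delta^{n-1}(C^{n-1}_b(F))$. The cup product is induced by $(f\smile f')(g_1,\dots,g_{n+m})=f(g_1,\dots,g_n)f'(g_{n+1},\dots,g_{n+m})$. For $\varphi:F\to\mathbb{R}$, $\delta^1\varphi(g,h)=\varphi(g)+\varphi(h)-\varphi(gh)$ and $D(\varphi)=\sup_{g,h}|\delta^1\varphi(g,h)|$ is the defect; $\varphi$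 is a quasimorphism if $D(\varphi)<\infty$, and then $[\delta^1\varphi]\in H^2_b(F)$. A primitive of a coboundary $f\in\delta^3(C^3_b(F))$ is a $\pi\in C^3_b(F)$ with $\delta^3\pi=f$; its norm is $\|\pi\|_\infty$. Words. $F$ has a fixed basis $S=\{s_1,\dots,s_n\}$; elements are reduced words, $|w|$ is word length, a product is reduced if there is no cancellation. $w$ is a subword of $g$ if $g=uwv$ as a reduced product; it is proper if $w\ne g$. Words $w_1,w_2$ overlap properly if, for some $i\in\{1,2\}$, $w_i=xy$ and $w_{3-i}=yz$ as reduced products with $x,y,z\neq1$; they overlap if they overlap properly or one is a proper subword of the other. $w$ is self-overlapping if it overlaps itself; $\mathcal{N}$ is the set of non-self-overlapping words. For any $w\ne1$ (possibly self-overlapping) the big Brooks quasimorphism is $H_w(g)=$ (number of possibly overlapping occurrences of $w$ as a subword of $g$) $-$ (number of such occurrences of $w^{-1}$); for $w\in\mathcal N$ put $h_w=H_w$. A family $I\subset F$ is independent if no two words in $I$ overlap (so all its words are non-self-overlapping), symmetric if $I=I^{-1}$. $\ell^1_{Ind}$. Let $\alpha:F\to\mathbb{R}$ be alternating ($\alpha_{w^{-1}}=-\alpha_w$) and supported on $\mathcal N$; with $\mathcal N^+\subset\mathcal N$ containing exactly one of $w,w^{-1}$ for each $1\neq w\in\mathcal N$, $\varphi_\alpha:=\sum_{w\in\mathcal N^+}\alpha_wh_w$ (a finite sum at each element). $\ell^1_{Ind}$ is the set of $\varphi_\alpha$ such that $\alpha=\sum_{i\ge1}\alpha_i$ with each $\alpha_i$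 bounded, alternating, supported on a symmetric independent family $I_i$, and $\sum_i\|\alpha_i\|_\infty<\infty$; $SInd_\alpha$ is the infimum of $\sum_i\|\alpha_i\|_\infty$ over all such expressions. Rolli quasimorphisms. For $\lambda=(\lambda_1,\dots,\lambda_n)$ with $\lambda_i:\mathbb{Z}\to\mathbb{R}$ bounded and alternating, $\phi_\lambda(g)=\sum_j\lambda_{i_j}(m_j)$, where $g=\prod_j s_{i_j}^{m_j}$ is the unique expression with $s_{i_j}\neq s_{i_{j+1}}$, $m_j\in\mathbb{Z}\setminus\{0\}$ ($\phi_\lambda(1)=0$). $\|\lambda\|_\infty=\max_i\|\lambda_i\|_\infty$. *)

(* Defs.v *)
From HB Require Import structures.
From mathcomp Require Import all_boot all_order all_algebra.
From mathcomp Require Import all_classical all_reals all_analysis.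
Set Implicit Arguments.
Unset Strict Implicit.
Unset Printing Implicit Defensive.
Import Order.TTheory GRing.Theory Num.Theory.
Import numFieldNormedType.Exports.

Local Open Scope classical_set_scope.
Local Open Scope ring_scope.

Section FreeGroup.
Variable n : nat.

(* The letter (i, false) is the basis element s_i, and (i, true) its inverse. *)
Definition letter := ('I_n * bool)%type.

Definition linv (a : letter) : letter := (a.1, ~~ a.2).

Definition reduced (s : seq letter) : bool :=
  sorted (fun a b => b != linv a) s.
Arguments reduced : simpl never.

(* The free group of rank n, realized on its reduced words. *)
Record freeGroup := FreeGroup { word :> seq letter; _ : reduced word }.
HB.instance Definition _ := [isSub for word].
HB.instance Definition _ := [Countable of freeGroup by <:].

(* Reduced form of the product of the letter a and the reduced word s. *)
Definition push (a : letter) (s : seq letter) : seq letter :=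
  if s is b :: s' then if b == linv a then s' else a :: s else [:: a].

Lemma linvK : involutive linv.
Proof. by case=> i b; rewrite /linv /= negbK. Qed.

Lemma eq_linv a b : (b == linv a) = (a == linv b).
Proof. by apply/eqP/eqP => ->; rewrite linvK. Qed.

Lemma reduced_cons a s :
  reduced (a :: s) = (if s is b :: _ then b != linv a else true) && reduced s.
Proof. by case: s. Qed.

Lemma reduced_push a s : reduced s -> reduced (push a s).
Proof.
case: s => // b s rs /=; case: ifPn => [_|ne]; last by rewrite reduced_cons ne.
by move: rs; rewrite reduced_cons => /andP[].
Qed.

Lemma pushK a s : reduced s -> push (linv a) (push a s) = s.
Proof.
case: s => [|b s] /=; first by rewrite linvK eqxx.
case: ifPn => [/eqP ->|ne] rs /=; last by rewrite linvK eqxx.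
case: s rs => [//|c s]; rewrite reduced_cons linvK => /andP[ne _] /=.
by rewrite linvK (negPf ne).
Qed.

Lemma pushVK a s : reduced s -> push a (push (linv a) s) = s.
Proof. by move=> rs; rewrite -{1}[a]linvK pushK. Qed.

Lemma reduced_foldr u s : reduced s -> reduced (foldr push s u).
Proof. by move=> rs; elim: u => //= a u; apply: reduced_push. Qed.

Lemma foldr_push_reduced u : reduced u -> foldr push [::] u = u.
Proof.
elim: u => //= a u IHu; rewrite reduced_cons => /andP[ne ru].
by rewrite (IHu ru); case: u ne {IHu ru} => //= b u /negPf ->.
Qed.

Lemma foldr_push_push a s t :
  reduced t -> foldr push t (push a s) = push a (foldr push t s).
Proof.
move=> rt; case: s => //= b s; case: ifPn => // /eqP ->.
by rewrite pushVK // reduced_foldr.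
Qed.

Lemma foldr_pushA u s t : reduced t ->
  foldr push t (foldr push s u) = foldr push (foldr push t s) u.
Proof. by move=> rt; elim: u => //= a u <-; rewrite foldr_push_push. Qed.

Definition fg_one := @FreeGroup [::] isT.

Lemma word_reduced (u : freeGroup) : reduced u.
Proof. by case: u. Qed.

Definition fg_mul (u v : freeGroup) : freeGroup :=
  FreeGroup (reduced_foldr u (word_reduced v)).

Lemma reduced_inv u : reduced u -> reduced (rev (map linv u)).
Proof.
rewrite /reduced rev_sorted sorted_map; apply: sub_sorted => a b /=.
by rewrite linvK eq_sym.
Qed.

Definition fg_inv (u : freeGroup) : freeGroup :=
  FreeGroup (reduced_inv (word_reduced u)).

Lemma fg_mulA : associative fg_mul.
Proof.
by move=> u v w; apply: val_inj; rewrite /= foldr_pushA // word_reduced.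
Qed.

Lemma fg_mul1g : left_id fg_one fg_mul.
Proof. by move=> u; apply: val_inj. Qed.

Lemma fg_mulg1 : right_id fg_one fg_mul.
Proof. by move=> u; apply: val_inj; rewrite /= foldr_push_reduced // word_reduced. Qed.

Lemma fg_mulVg : left_inverse fg_one fg_inv fg_mul.
Proof.
move=> u; apply: val_inj => /=; have := word_reduced u.
elim: (word u) => //= a s IHs ra.
have rs : reduced s by move: ra; rewrite reduced_cons => /andP[].
rewrite rev_cons -cats1 foldr_cat /= eq_sym linvK eqxx.
exact: IHs.
Qed.

Lemma fg_invK : involutive fg_inv.
Proof.
move=> u; apply: val_inj => /=.
by rewrite map_rev revK -map_comp map_id_in // => a _; rewrite /= linvK.
Qed.

Lemma fg_mulgV : right_inverse fg_one fg_inv fg_mul.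
Proof. by move=> u; rewrite -{1}[u]fg_invK fg_mulVg. Qed.

HB.instance Definition _ :=
  isGroup.Build freeGroup fg_mulA fg_mul1g fg_mulg1 fg_mulVg fg_mulgV.

End FreeGroup.
Arguments reduced {n} s : simpl never.

Section BoundedCohomology.
Variables (R : realType) (G : groupType).

(* Valued in \bar R; it is +oo exactly when f is unbounded. *)
Definition supnorm (T : Type) (f : T -> R) : \bar R :=
  ereal_sup (range (fun x => (`|f x|)%:E)).

Definition bounded (T : Type) (f : T -> R) : Prop := (supnorm f < +oo)%E.

Definition cochain (n : nat) := n.-tuple G -> R.

Definition Cb (n : nat) : set (cochain n) := [set f | bounded f].

(* The three kinds of faces below are (g_2, .., g_{n+1}),
   (g_1, .., g_n) and (g_1, .., g_i g_{i+1}, .., g_{n+1}), with indices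
   shifted to start at 0. *)
Definition face_first n (g : n.+1.-tuple G) : n.-tuple G :=
  [tuple tnth g (lift ord0 j) | j < n].

Definition face_last n (g : n.+1.-tuple G) : n.-tuple G :=
  [tuple tnth g (widen_ord (leqnSn n) j) | j < n].

Definition face_mul n (i : 'I_n) (g : n.+1.-tuple G) : n.-tuple G :=
  [tuple if (j < i)%N then tnth g (widen_ord (leqnSn n) j)
         else if j == i then
           (tnth g (widen_ord (leqnSn n) j) * tnth g (lift ord0 j))%g
         else tnth g (lift ord0 j) | j < n].

Definition delta n (f : cochain n) : cochain n.+1 := fun g =>
  f (face_first g) + \sum_(i < n) (-1) ^+ i.+1 * f (face_mul i g)
  + (-1) ^+ n.+1 * f (face_last g).

Definition Zb n : set (cochain n) := [set f | Cb f /\ delta f = fun=> 0].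

Definition Bb n : set (cochain n) :=
  match n return set (cochain n) with
  | 0 => [set fun=> 0]
  | k.+1 => [set delta p | p in @Cb k]
  end.

(* Elements of H^n_b(G) are represented by the cosets of Bb in Zb.  The coset
   is empty when f is not itself a bounded cocycle. *)
Definition bclass n (f : cochain n) : set (cochain n) :=
  [set f' | Zb f /\ Zb f' /\ Bb (f' \- f)].

Definition bzero n : set (cochain n) := bclass (fun=> 0).

Definition cup n m (f : cochain n) (f' : cochain m) : cochain (n + m) :=
  fun g => f [tuple tnth g (lshift m i) | i < n] *
           f' [tuple tnth g (rshift n j) | j < m].

Definition cup_class n m (A : set (cochain n)) (B : set (cochain m)) :
  set (cochain (n + m)) := \bigcup_(f in A) \bigcup_(f' in B) bclass (cup f f').

Definition is_primitive n (p : cochain n) (f : cochain n.+1) : Prop :=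
  Cb p /\ delta p = f.

Definition delta1 (phi : G -> R) : cochain 2 :=
  @delta 1 (fun t => phi (thead t)).

Definition defect (phi : G -> R) : \bar R := supnorm (delta1 phi).

Lemma delta1E (phi : G -> R) (g h : G) :
  delta1 phi [tuple g; h] = phi g + phi h - phi (g * h)%g.
Proof.
rewrite /delta1 /delta big_ord1 /= /thead !tnth_mktuple /= !(tnth_nth g) /=.
by rewrite expr1 mulN1r expr2 mulN1r opprK mul1r addrAC [phi h + _]addrC.
Qed.

End BoundedCohomology.
Arguments bzero R G n : clear implicits.

Section Words.
Variables (R : realType) (n : nat).
Local Notation F := (freeGroup n).

(* A product of elements of F is reduced when the word of the product is the
   concatenation of their words, so "w is a subword of g" is [infix w g]. *)
Definition proper_subword (w g : F) : Prop := infix w g /\ w <> g.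

Definition ends_begin (w1 w2 : F) : Prop :=
  exists x y z : F,
    [/\ x <> 1%g, y <> 1%g & z <> 1%g] /\
    word w1 = word x ++ word y /\ word w2 = word y ++ word z.

Definition overlap_properly (w1 w2 : F) : Prop :=
  ends_begin w1 w2 \/ ends_begin w2 w1.

Definition overlap (w1 w2 : F) : Prop :=
  [\/ overlap_properly w1 w2, proper_subword w1 w2 | proper_subword w2 w1].

Definition non_self_overlapping : set F := [set w | ~ overlap w w].

Definition independent (I : set F) : Prop :=
  forall w1 w2, I w1 -> I w2 -> ~ overlap w1 w2.

Definition symmetric_family (I : set F) : Prop := [set w^-1%g | w in I] = I.

Definition occurrences (w g : F) : nat :=
  count (fun i => prefix w (drop i g)) (iota 0 (size g).+1).

Definition brooks (w : F) (g : F) : R :=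
  (occurrences w g)%:R - (occurrences w^-1%g g)%:R.

Definition alternating (alpha : F -> R) : Prop :=
  forall w, alpha w^-1%g = - alpha w.

Definition supported_on (A : set F) (alpha : F -> R) : Prop :=
  forall w, ~ A w -> alpha w = 0.

Definition half_system (Np : set F) : Prop :=
  Np `<=` non_self_overlapping /\
  forall w, non_self_overlapping w -> w <> 1%g ->
    (Np w /\ ~ Np w^-1%g) \/ (~ Np w /\ Np w^-1%g).

Definition brooks_sum (Np : set F) (alpha : F -> R) (g : F) : R :=
  \sum_(w \in Np) alpha w * brooks w g.

(* A finitely supported big sum over an infinite support would be 0; this
   shows that the sum above always ranges over a finite support. *)
Lemma finite_brooks (g : F) : finite_set [set w | brooks w g != 0].
Proof.
pose P (w : F) := word w \in
  [seq take j (drop i g) | i <- iota 0 (size g).+1, j <- iota 0 (size g).+1].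
have occP w : (occurrences w g != 0)%N -> P w.
  rewrite -lt0n -has_count => /hasP[i i_in /prefixP[s eqs]].
  apply/allpairsP; exists (i, size w); split=> //.
    rewrite mem_iota leq0n add0n ltnS.
    by apply: leq_trans (leq_subr i _); rewrite -size_drop eqs size_cat leq_addr.
  by rewrite /= eqs take_size_cat.
have finP : finite_set [set w | P w].
  rewrite /P; set s := [seq take _ _ | _ <- _, _ <- _].
  apply: (@sub_finite_set _ _ [set` pmap (insub : _ -> option F) s]) => //.
  move=> w ws; suff: w \in pmap (insub : _ -> option F) s by [].
  by rewrite mem_pmap; apply/mapP; exists (word w) => //; exact/esym/valK.
apply: (@sub_finite_set _ _ ([set w | P w] `|` [set w^-1%g | w in [set w | P w]])).
  move=> w /=; have [e0|/occP Pw _] := eqVneq (occurrences w g) 0%N; last by left.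
  have [e1|/occP Pw _] := eqVneq (occurrences w^-1%g g) 0%N.
    by rewrite /brooks e0 e1 subrr eqxx.
  by right; exists (w^-1%g) => //; rewrite invgK.
by rewrite finite_setU; split=> //; apply: finite_image.
Qed.

Definition ind_decomposition (alpha : F -> R) (a : nat -> F -> R) : Prop :=
  [/\ forall i, exists I : set F,
        [/\ independent I, symmetric_family I & supported_on I (a i)],
      forall i, bounded (a i) /\ alternating (a i),
      forall w, series (fun i => a i w) @ \oo --> alpha w
    & (\sum_(0 <= i <oo) supnorm (a i) < +oo)%E].

(* brooks_sum Np alpha belongs to l^1_Ind, for any half system Np. *)
Definition l1Ind (alpha : F -> R) : Prop :=
  [/\ alternating alpha, supported_on non_self_overlapping alpha
    & exists a, ind_decomposition alpha a].

Definition SInd (alpha : F -> R) : \bar R :=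
  ereal_inf [set (\sum_(0 <= i <oo) supnorm (a i))%E
            | a in ind_decomposition alpha].

(* The decomposition g = s_{i_1}^{m_1} ... s_{i_k}^{m_k}, as the sequence of
   the pairs (i_j, m_j); see syllablesP. *)
Fixpoint syllables (s : seq (letter n)) : seq ('I_n * int) :=
  if s is a :: s' then
    let e : int := if a.2 then -1 else 1 in
    match syllables s' with
    | (i, m) :: t => if i == a.1 then (i, e + m) :: t
                     else (a.1, e) :: (i, m) :: t
    | [::] => [:: (a.1, e)]
    end
  else [::].

Definition power_word (p : 'I_n * int) : seq (letter n) :=
  nseq `|p.2|%N (p.1, p.2 < 0).

Lemma syllablesP (g : F) :
  [/\ sorted (fun p q => p.1 != q.1) (syllables g),
      all (fun p => p.2 != 0) (syllables g)
    & flatten (map power_word (syllables g)) = word g].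
Proof.
have := word_reduced g; elim: (word g) => //= -[k b] s IHs.
rewrite reduced_cons => /andP[hd /IHs[{IHs}]] /=.
case: (syllables s) => [|[i m] t] /=.
  by move=> _ _ <-; case: b {hd} => //.
move=> srt /andP[m0 nz] def_s; case: ifPn => [/eqP eik|ne].
  rewrite {i}eik in srt def_s *.
  have sgn : (m < 0) = b.
    move: hd; rewrite -def_s /power_word /=.
    case: m m0 {srt def_s} => [[|m]|m] //= _; rewrite /linv /= xpair_eqE eqxx /=;
      by case: b.
  have step : [/\ (if b then -1 else 1 : int) + m != 0,
      `|((if b then -1 else 1 : int) + m)%R|%N = `|m|%N.+1
      & ((if b then -1 else 1 : int) + m < 0) = b].
    by case: b sgn {hd} => //; case: m m0 {srt def_s} => [[|m]|m].
  case: step => h0 h1 h2; split; [by case: (t) srt | exact/andP |].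
  by rewrite -def_s /power_word /= h1 h2 sgn.
split; first by rewrite /= eq_sym ne.
  by rewrite /= m0 nz; case: (b).
by rewrite -def_s /power_word /=; case: (b).
Qed.

Definition alternatingZ (f : int -> R) : Prop := forall m, f (- m) = - f m.

Definition rolli (lambda : 'I_n -> int -> R) (g : F) : R :=
  \sum_(p <- syllables g) lambda p.1 p.2.

Definition rolli_norm (lambda : 'I_n -> int -> R) : \bar R :=
  \big[Order.max/0%E]_(i < n) supnorm (lambda i).

End Words.

(* Main.v *)
Require Import Defs.
From HB Require Import structures.
From mathcomp Require Import all_boot all_order all_algebra.
From mathcomp Require Import all_classical all_reals all_analysis.
From mathcomp Require Import ring lra zify.
Import Order.TTheory GRing.Theory Num.Theory.
Import numFieldNormedType.Exports.
Local Open Scope classical_set_scope.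
Local Open Scope ring_scope.

Set Implicit Arguments.
Unset Strict Implicit.
Unset Printing Implicit Defensive.

(* Each of the two left factors is a sum phi(g) of weights of pieces [i, j) of
   the reduced word g, where a weight only sees the neighbourhood of its piece,
   changes sign under inversion of the word, and the weights of the pieces
   meeting a given cut have bounded sum M.  Put omega = delta1 psi.  The cochain
   phi \cup omega is an unbounded primitive of delta1 phi \cup omega; correct it
   by the coboundary of
     eta(g, h) = sum over the pieces of g of
       weight * (omega(suffix at i, h) + omega(suffix at j, h)) / 2.
   The cocycle identity turns the corrected primitive into an alternating sum,
   over the sides of the triangle g, h, gh, of such averages for
   omega(_, k).  Because of the average, the pieces of g and h lost in the
   cancellation of gh contribute opposite terms, the others contribute the
   same terms to gh, and only pieces meeting the center of the tripod remain:
   the primitive is bounded by 3 M D(psi), for any quasimorphism psi.  Pieces are the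
   words of the support of alpha for the Brooks sums, M being at most
   2 SInd(alpha) since at most two words of an independent family meet a cut,
   and maximal syllables for Rolli quasimorphisms. *)

(** * Coboundaries in low degrees, written out on explicit tuples *)

Section Coboundary.
Variables (R : realType) (G : groupType).
Implicit Types a b c d e : G.

Ltac face_tac a :=
  apply: eq_from_tnth => -[[|[|[|[|[]]]]]] // ?;
  rewrite tnth_mktuple /= -?val_eqE !(tnth_nth a) //=.

Lemma delta1_cochainE (f : cochain R G 1) a b :
  delta f [tuple a; b] = f [tuple a] + f [tuple b] - f [tuple (a * b)%g].
Proof.
rewrite /delta !big_ord_recl big_ord0.
have -> : face_first [tuple a; b] = [tuple b] by face_tac a.
have -> : face_last [tuple a; b] = [tuple a] by face_tac a.
have -> : face_mul ord0 [tuple a; b] = [tuple (a * b)%g] by face_tac a.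
by rewrite /= /bump /=; ring.
Qed.

Lemma delta2E (f : cochain R G 2) a b c :
  delta f [tuple a; b; c] =
  f [tuple b; c] - f [tuple (a * b)%g; c] + f [tuple a; (b * c)%g]
  - f [tuple a; b].
Proof.
rewrite /delta !big_ord_recl big_ord0.
have -> : face_first [tuple a; b; c] = [tuple b; c] by face_tac a.
have -> : face_last [tuple a; b; c] = [tuple a; b] by face_tac a.
have -> : face_mul ord0 [tuple a; b; c] = [tuple (a * b)%g; c] by face_tac a.
have -> : face_mul (lift ord0 ord0) [tuple a; b; c] = [tuple a; (b * c)%g].
  by face_tac a.
by rewrite /= /bump /=; ring.
Qed.

Lemma delta3E (f : cochain R G 3) a b c d :
  delta f [tuple a; b; c; d] =
  f [tuple b; c; d] - f [tuple (a * b)%g; c; d] + f [tuple a; (b * c)%g; d]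
  - f [tuple a; b; (c * d)%g] + f [tuple a; b; c].
Proof.
rewrite /delta !big_ord_recl big_ord0.
set g := [tuple a; b; c; d].
have -> : face_first g = [tuple b; c; d] by face_tac a.
have -> : face_last g = [tuple a; b; c] by face_tac a.
have -> : face_mul ord0 g = [tuple (a * b)%g; c; d] by face_tac a.
have -> : face_mul (lift ord0 ord0) g = [tuple a; (b * c)%g; d] by face_tac a.
have -> : face_mul (lift ord0 (lift ord0 ord0)) g = [tuple a; b; (c * d)%g].
  by face_tac a.
by rewrite /= /bump /=; ring.
Qed.

Lemma delta4E (f : cochain R G 4) a b c d e :
  delta f [tuple a; b; c; d; e] =
  f [tuple b; c; d; e] - f [tuple (a * b)%g; c; d; e]
  + f [tuple a; (b * c)%g; d; e] - f [tuple a; b; (c * d)%g; e]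
  + f [tuple a; b; c; (d * e)%g] - f [tuple a; b; c; d].
Proof.
rewrite /delta !big_ord_recl big_ord0.
set g := [tuple a; b; c; d; e].
have -> : face_first g = [tuple b; c; d; e] by face_tac a.
have -> : face_last g = [tuple a; b; c; d] by face_tac a.
have -> : face_mul ord0 g = [tuple (a * b)%g; c; d; e] by face_tac a.
have -> : face_mul (lift ord0 ord0) g = [tuple a; (b * c)%g; d; e].
  by face_tac a.
have -> : face_mul (lift ord0 (lift ord0 ord0)) g
          = [tuple a; b; (c * d)%g; e] by face_tac a.
have -> : face_mul (lift ord0 (lift ord0 (lift ord0 ord0))) g
          = [tuple a; b; c; (d * e)%g] by face_tac a.
by rewrite /= /bump /=; ring.
Qed.

Lemma cup22E (f f' : cochain R G 2) a b c d :
  @cup R G 2 2 f f' [tuple a; b; c; d] = f [tuple a; b] * f' [tuple c; d].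
Proof. by rewrite /cup; congr (f _ * f' _); face_tac a. Qed.

End Coboundary.

(** * Bounded cocycles, and vanishing of a cup product of classes *)

Section BoundedClasses.
Variables (R : realType) (G : groupType).
Implicit Types a b c d e : G.

Lemma ler_supnorm (T : Type) (f : T -> R) x : ((`|f x|)%:E <= supnorm f)%E.
Proof. by apply: ereal_sup_ubound; exists x. Qed.

Lemma supnorm_ler (T : Type) (f : T -> R) (M : \bar R) :
  (forall x, (`|f x|)%:E <= M)%E -> (supnorm f <= M)%E.
Proof. by move=> fM; apply: ge_ereal_sup => _ [x _ <-]. Qed.

Lemma boundedP (T : Type) (f : T -> R) :
  bounded f <-> exists M, forall x, `|f x| <= M.
Proof.
split=> [bf|[M fM]]; last first.
  apply: (@le_lt_trans _ _ M%:E); last by rewrite ltry.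
  by apply: supnorm_ler => x; rewrite lee_fin.
exists (fine (supnorm f)) => x; have fx := ler_supnorm f x.
rewrite -lee_fin fineK // fin_numE -ltey bf andbT -ltNye.
by apply: lt_le_trans fx; rewrite ltNyr.
Qed.

Lemma tuple2E (t : 2.-tuple G) : exists a b, t = [tuple a; b].
Proof. by case/tupleP: t => a /tupleP[b t]; exists a, b; rewrite (tuple0 t); apply: val_inj. Qed.

Lemma tuple3E (t : 3.-tuple G) : exists a b c, t = [tuple a; b; c].
Proof.
case/tupleP: t => a t; have [b [c ->]] := tuple2E t.
by exists a, b, c; apply: val_inj.
Qed.

Lemma tuple4E (t : 4.-tuple G) : exists a b c d, t = [tuple a; b; c; d].
Proof.
case/tupleP: t => a t; have [b [c [d ->]]] := tuple3E t.
by exists a, b, c, d; apply: val_inj.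
Qed.

Lemma tuple5E (t : 5.-tuple G) : exists a b c d e, t = [tuple a; b; c; d; e].
Proof.
case/tupleP: t => a t; have [b [c [d [e ->]]]] := tuple4E t.
by exists a, b, c, d, e; apply: val_inj.
Qed.

Lemma delta1_cocycle (phi : G -> R) a b c :
  delta1 phi [tuple b; c] - delta1 phi [tuple (a * b)%g; c]
  + delta1 phi [tuple a; (b * c)%g] - delta1 phi [tuple a; b] = 0.
Proof. by rewrite !delta1E mulgA; ring. Qed.

Lemma delta2_tuple0 (f : cochain R G 2) :
  (forall a b c, f [tuple b; c] - f [tuple (a * b)%g; c]
    + f [tuple a; (b * c)%g] - f [tuple a; b] = 0) -> delta f = fun=> 0.
Proof.
move=> f0; apply/funext => t; have [a [b [c ->]]] := tuple3E t.
by rewrite delta2E f0.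
Qed.

Lemma Zb_delta1 (phi : G -> R) : bounded (delta1 phi) -> Zb (delta1 phi).
Proof. by move=> bphi; split=> //; apply: delta2_tuple0 => *; apply: delta1_cocycle. Qed.

Lemma Zb2P (f : cochain R G 2) : Zb f -> forall a b c,
  f [tuple b; c] - f [tuple (a * b)%g; c] + f [tuple a; (b * c)%g]
  - f [tuple a; b] = 0.
Proof. by case=> _ df a b c; rewrite -delta2E df. Qed.

Lemma bclass_delta1P (phi : G -> R) (f : cochain R G 2) :
  bclass (delta1 phi) f -> Zb f /\ exists b : G -> R,
  bounded b /\ forall x y, f [tuple x; y] = delta1 phi [tuple x; y]
     + (b x + b y - b (x * y)%g).
Proof.
move=> [_ [Zf [b /boundedP[M bM] db]]]; split=> //.
exists (fun x => b [tuple x]); split; first by apply/boundedP; exists M.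
move=> x y; rewrite -delta1_cochainE db /=; ring.
Qed.

Lemma Bb_delta n (p : cochain R G n) (f : cochain R G n.+1) :
  Cb p -> delta p = f -> Bb f.
Proof. by move=> Cp pf; exists p. Qed.

(** [cup_class] is a union over all representatives. If [f] and [f'] differ from [delta1 phi] and
    [delta1 psi] by coboundaries of bounded [b] and [b'], the Leibniz rule makes [p] plus the cup
    products of [b] with [f'] and of [delta1 phi] with [b'] a bounded primitive of the cup product
    of [f] and [f']. *)
Lemma cup_class_delta1_eq0 (phi psi : G -> R) (p : cochain R G 3) :
  bounded (delta1 phi) -> bounded (delta1 psi) ->
  is_primitive p (@cup R G 2 2 (delta1 phi) (delta1 psi)) ->
  @cup_class R G 2 2 (bclass (delta1 phi)) (bclass (delta1 psi)) = bzero R G 4.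
Proof.
move=> bphi bpsi [/boundedP[Mp bp] dp].
have Z0 : Zb ((fun=> 0) : cochain R G 4).
  split; first by apply/boundedP; exists 0 => x; rewrite normr0.
  by apply/funext=> t; have [a [b [c [d [e ->]]]]] := tuple5E t; rewrite delta4E; ring.
have Zcup (f f' : cochain R G 2) : Zb f -> Zb f' -> Zb (@cup R G 2 2 f f').
  move=> Zf Zf'; have [/boundedP[M bM] _] := Zf.
  have [/boundedP[M' bM'] _] := Zf'; split.
    by apply/boundedP; exists (M * M') => t; rewrite normrM ler_pM.
  apply/funext=> t; have [a [b [c [d [e ->]]]]] := tuple5E t.
  rewrite delta4E !cup22E.
  (* Leibniz rule for two cocycles: each identity is solved for its last term, and the alternating
     sum cancels. *)
  have /eqP := Zb2P Zf a b c; rewrite subr_eq0 => /eqP <-.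
  have /eqP := Zb2P Zf' c d e; rewrite subr_eq0 => /eqP <-.
  ring.
have self (f : cochain R G 2) : Zb f -> bclass f f.
  move=> Zf; split=> //; split=> //; apply: (@Bb_delta _ (fun=> 0)).
    by apply/boundedP; exists 0 => x; rewrite normr0.
  by apply/funext=> t; have [a [b ->]] := tuple2E t; rewrite delta1_cochainE /=; ring.
apply/seteqP; split=> x.
  move=> [f] /bclass_delta1P[Zf [b [/boundedP[Mb bb] fE]]].
  move=> [f'] /bclass_delta1P[Zf' [b' [/boundedP[Mb' bb'] fE']]].
  move=> [_ [Zx [q Cq dq]]]; do 2![split=> //].
  have /boundedP[Mq bq] := Cq.
  have [/boundedP[Mf bf] _] := Zf'; have /boundedP[Mphi bdphi] := bphi.
  apply: (@Bb_delta _ (fun t => q t + (p t + (b (tnth t ord0) *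
      f' [tuple tnth t (inord 1); tnth t (inord 2)]
      + delta1 phi [tuple tnth t ord0; tnth t (inord 1)]
         * b' (tnth t (inord 2)))))).
    apply/boundedP; exists (Mq + (Mp + (Mb * Mf + Mphi * Mb'))) => t.
    rewrite (le_trans (ler_normD _ _))// lerD//.
    rewrite (le_trans (ler_normD _ _))// lerD//.
    rewrite (le_trans (ler_normD _ _))// lerD// normrM ler_pM//.
  apply/funext=> t; have [x1 [x2 [x3 [x4 ->]]]] := tuple4E t.
  have := congr1 (@^~ [tuple x1; x2; x3; x4]) dq.
  have := congr1 (@^~ [tuple x1; x2; x3; x4]) dp.
  rewrite /= !delta3E !cup22E !(tnth_nth x1) /= !inordK //= => ep eq.
  have H1 := congr1 ( *%R (b x1)) (Zb2P Zf' x2 x3 x4).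
  have H2 := congr1 ( *%R^~ (b' x4)) (delta1_cocycle phi x1 x2 x3).
  have H3 := congr1 ( *%R (delta1 phi [tuple x1; x2])) (fE' x3 x4).
  have H4 := congr1 ( *%R^~ (f' [tuple x3; x4])) (fE x1 x2).
  rewrite /= in H1 H2 H3 H4; lra.
move=> [_ [Zx [q Cq dq]]].
(* For the converse inclusion the representatives [delta1 phi] and [delta1 psi] themselves serve,
   with [q - p] as primitive of the difference. *)
have Zphi := Zb_delta1 bphi; have Zpsi := Zb_delta1 bpsi.
exists (delta1 phi); first exact: self.
exists (delta1 psi); first exact: self.
split; first exact: Zcup.
split=> //; apply: (@Bb_delta _ (fun t => q t - p t)).
  have /boundedP[Mq bq] := Cq; apply/boundedP; exists (Mq + Mp) => t.
  by rewrite (le_trans (ler_normB _ _))// lerD.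
apply/funext=> t; have [x1 [x2 [x3 [x4 ->]]]] := tuple4E t.
have := congr1 (@^~ [tuple x1; x2; x3; x4]) dq.
have := congr1 (@^~ [tuple x1; x2; x3; x4]) dp.
rewrite /= !delta3E; lra.
Qed.

End BoundedClasses.

(** * Words, their formal inverses, and the tripod of a product *)

Section ReducedWords.
Variable n : nat.
Local Notation F := (freeGroup n).
Local Notation letter := (letter n).
Implicit Types (g h : F) (s t : seq letter).

(** Free reduction of any list of letters. It turns concatenation into product, so suffixes of a
    word can be handled as group elements. *)
Definition red s : F := FreeGroup (reduced_foldr s (isT : reduced [::])).

Lemma red_word g : red (word g) = g.
Proof. by apply: val_inj; rewrite /= foldr_push_reduced // word_reduced. Qed.

Lemma word_red s : reduced s -> word (red s) = s.
Proof. exact: foldr_push_reduced. Qed.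

Lemma red_cat s t : red (s ++ t) = (red s * red t)%g.
Proof.
apply: val_inj; rewrite /= foldr_cat foldr_pushA //.
by apply: reduced_foldr.
Qed.

Definition winv s : seq letter := rev (map (@linv n) s).

Lemma size_winv s : size (winv s) = size s.
Proof. by rewrite size_rev size_map. Qed.

Lemma winv_cat s t : winv (s ++ t) = winv t ++ winv s.
Proof. by rewrite /winv map_cat rev_cat. Qed.

Lemma winvK : involutive winv.
Proof. by move=> s; rewrite /winv map_rev revK mapK //; apply: linvK. Qed.

Lemma take_winv k s : take k (winv s) = winv (drop (size s - k) s).
Proof. by rewrite /winv take_rev map_drop size_map. Qed.

Lemma drop_winv k s : drop k (winv s) = winv (take (size s - k) s).
Proof. by rewrite /winv drop_rev map_take size_map. Qed.

Lemma word_inv g : word g^-1%g = winv (word g).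
Proof. by []. Qed.

Lemma red_winv s : reduced s -> red (winv s) = (red s)^-1%g.
Proof.
move=> rs; apply: val_inj; rewrite [RHS]word_inv word_red //.
by rewrite [LHS]word_red //; apply: reduced_inv.
Qed.

Lemma reduced_catl s t : reduced (s ++ t) -> reduced s.
Proof.
by elim: s => //= a s IHs; rewrite !reduced_cons => /andP[+ /IHs->]; case: (s) => //= ? ? ->.
Qed.

Lemma reduced_catr s t : reduced (s ++ t) -> reduced t.
Proof. by elim: s => //= a s IHs; rewrite reduced_cons => /andP[_ /IHs]. Qed.

Lemma reduced_take k s : reduced s -> reduced (take k s).
Proof. by rewrite -{1}(cat_take_drop k s) => /reduced_catl. Qed.

Lemma reduced_drop k s : reduced s -> reduced (drop k s).
Proof. by rewrite -{1}(cat_take_drop k s) => /reduced_catr. Qed.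

Lemma red_winv_take k s : reduced s ->
  red (winv (take k s)) = (red (drop k s) * (red s)^-1)%g.
Proof.
move=> rs; rewrite red_winv ?reduced_take // -[in (red s)^-1%g](cat_take_drop k s).
by rewrite red_cat invgM mulgA mulgV mul1g.
Qed.

(** [A], [B], [C] are the legs of the tripod. Induction on [g]: a new first letter lengthens [A],
    unless [A] is empty and the letter cancels the head of [C]; that head then moves into the
    cancelled leg [B]. *)
Lemma triangle g h : exists A B C : seq letter,
  [/\ word g = A ++ B, word h = winv B ++ C & word (g * h)%g = A ++ C].
Proof.
rewrite [word (g * h)%g]/=; move: (word_reduced g) (word_reduced h).
elim: (word g) => [|a s IHs] /= rg rh; first by exists [::], [::], (word h).
have [A [B [C [sE hE pE]]]] := IHs (reduced_catr (s := [:: a]) rg) rh.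
rewrite {}pE; case: A sE => [|b A] sE /=; last first.
  exists [:: a, b & A], B, C; rewrite sE; split=> //=.
  by move: rg; rewrite sE reduced_cons => /andP[/negPf->].
case: C hE => [|c C] hE /=; first by exists [:: a], s, [::]; rewrite sE.
case: ifPn => [/eqP cE|_]; last by exists [:: a], s, (c :: C); rewrite sE.
exists [::], (a :: s), C; split=> //.
by rewrite -[a :: s]/([:: a] ++ s) winv_cat hE sE cE -catA.
Qed.

End ReducedWords.

(** * Local weights on pieces of words, and the bounded primitive they yield *)

Section Weights.
Variables (R : realType) (n : nat).
Local Notation F := (freeGroup n).
Local Notation letter := (letter n).
Implicit Types (g h k : F) (s t : seq letter) (W : seq letter -> nat -> nat -> R).

(* [W s i j] is the weight of the piece of [s] between the cuts [i] and [j]. *)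
Record local_weight W : Prop := LocalWeight {
  weight_supp : forall s i j, ~~ (i < j)%N -> W s i j = 0;
  weight_catl : forall s t i j, (j < size s)%N -> W (s ++ t) i j = W s i j;
  weight_catr : forall s t i j, (0 < i)%N ->
    W (s ++ t) (size s + i)%N (size s + j)%N = W t i j;
  weight_inv : forall s i j, reduced s -> (i <= size s)%N -> (j <= size s)%N ->
    W (winv s) (size s - j)%N (size s - i)%N = - W s i j }.

Definition weight_sum W g : R :=
  \sum_(i < (size g).+1) \sum_(j < (size g).+1) W g i j.

(** Both inequalities are wide: a piece ending or starting exactly at [c] may have a weight that
    depends on the letter across the cut. *)
Definition touching W s (c : nat) : R :=
  \sum_(i < (size s).+1) \sum_(j < (size s).+1 | (i <= c <= j)%N) `|W s i j|.

Definition touch_bounded W (M : R) : Prop :=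
  forall s c, reduced s -> (c <= size s)%N -> touching W s c <= M.

(** Averaging over both ends makes the value symmetric in [i] and [j], hence compatible with
    inversion, which exchanges the ends of a piece. *)
Definition suffix_avg (f : F -> R) s (i j : nat) : R :=
  (f (red (drop i s)) + f (red (drop j s))) / 2.

Definition suffix_sum W s (f : F -> R) : R :=
  \sum_(i < (size s).+1) \sum_(j < (size s).+1) W s i j * suffix_avg f s i j.

(** For [i < j] exactly one of [j < p], [p < i], [i <= p <= j] holds. The shift by one in the second
    sum leaves the cut [p] itself to the third. *)
Lemma double_sum_cut (p q : nat) (X : nat -> nat -> R) :
  (forall i j, ~~ (i < j)%N -> X i j = 0) ->
  \sum_(i < (p + q).+1) \sum_(j < (p + q).+1) X i j =
  \sum_(i < p) \sum_(j < p) X i j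
  + \sum_(i < q) \sum_(j < q) X (p + i.+1)%N (p + j.+1)%N
  + \sum_(i < (p + q).+1) \sum_(j < (p + q).+1 | (i <= p <= j)%N) X i j.
Proof.
move=> X0; rewrite -addnS.
have -> : \sum_(i < p + q.+1) \sum_(j < p + q.+1) X i j =
    \sum_(i < p + q.+1) \sum_(j < p + q.+1) (if (j < p)%N then X i j else 0)
  + \sum_(i < p + q.+1) \sum_(j < p + q.+1) (if (p < i)%N then X i j else 0)
  + \sum_(i < p + q.+1) \sum_(j < p + q.+1 | (i <= p <= j)%N) X i j.
  under [X in _ = _ + X]eq_bigr => i _ do rewrite big_mkcond /=.
  rewrite -!big_split /=; apply: eq_bigr => i _.
  rewrite -!big_split /=; apply: eq_bigr => j _.
  have [ij|/X0->] := boolP (i < j)%N; last by rewrite !if_same !addr0.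
  case: (ltnP j p) => jp; case: (ltnP p i) => pi; rewrite ?andbF /= ?addr0 ?add0r //.
  by move: ij jp pi; lia.
congr (_ + _ + _).
- rewrite big_split_ord /= [X in _ + X]big1 ?addr0 => [|i _]; last first.
    rewrite big1 // => j _; case: ifP => // jp; apply: X0; lia.
  apply: eq_bigr => i _; rewrite big_split_ord /= [X in _ + X]big1 ?addr0.
    by apply: eq_bigr => j _; rewrite ltn_ord.
  by move=> j _; rewrite ltnNge leq_addr.
- rewrite big_split_ord /= [X in X + _]big1 ?add0r => [|i _]; last first.
    by rewrite big1 // => j _; rewrite ltnNge ltnW.
  rewrite big_ord_recl [X in X + _]big1 ?add0r => [|j _]; last by rewrite addn0 ltnn.
  apply: eq_bigr => i _; rewrite big_split_ord /= [X in X + _]big1 ?add0r.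
    rewrite big_ord_recl /= X0 ?if_same ?add0r; last by lia.
    apply: eq_bigr => j _; rewrite /bump /= -[X in (X < _)%N]addn0 ltn_add2l.
    by [].
  by move=> j _; case: ifP => // _; apply: X0; have := ltn_ord j; lia.
Qed.

(** [left_sum] keeps the pieces ending strictly before the end of [s], and [right_sum] those
    starting strictly after its beginning: their weights survive concatenation on that side. *)
Definition left_sum W s (f : F -> R) : R :=
  \sum_(i < size s) \sum_(j < size s) W s i j * suffix_avg f s i j.

Definition right_sum W s (f : F -> R) : R :=
  \sum_(i < size s) \sum_(j < size s) W s i.+1 j.+1 * suffix_avg f s i.+1 j.+1.

Definition touch_sum W s c (f : F -> R) : R :=
  \sum_(i < (size s).+1) \sum_(j < (size s).+1 | (i <= c <= j)%N)
     W s i j * suffix_avg f s i j.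

(** A suffix of [s ++ t] cut inside [s] is a suffix of [s] times [red t], whence the translated [f];
    one cut inside [t] is a suffix of [t]. *)
Lemma suffix_sum_cat W s t f : local_weight W ->
  suffix_sum W (s ++ t) f =
  left_sum W s (fun x => f (x * red t)%g) + right_sum W t f
  + touch_sum W (s ++ t) (size s) f.
Proof.
move=> lW; rewrite /suffix_sum /touch_sum size_cat.
rewrite (@double_sum_cut _ _ (fun i j => W (s ++ t) i j * suffix_avg f (s ++ t) i j));
  last by move=> i j ij; rewrite (weight_supp lW) ?mul0r.
congr (_ + _ + _); apply: eq_bigr => i _; apply: eq_bigr => j _.
  rewrite (weight_catl lW) // /suffix_avg.
  by rewrite !drop_cat !ltn_ord !red_cat.
rewrite (weight_catr lW) // /suffix_avg !drop_cat.
by rewrite !ltnNge !leq_addr /= !addKn.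
Qed.

(** Inversion mirrors the cuts, so it exchanges left and right pieces and changes the sign of
    weights. By [red_winv_take], a suffix of the inverse is the mirrored suffix of [s] times the
    inverse of [s]. *)
Lemma left_sum_winv W s f : local_weight W -> reduced s ->
  left_sum W (winv s) f = - right_sum W s (fun x => f (x * (red s)^-1)%g).
Proof.
move=> lW rs; rewrite /left_sum /right_sum size_winv.
rewrite exchange_big (reindex_inj rev_ord_inj) -sumrN /=; apply: eq_bigr => i _.
rewrite (reindex_inj rev_ord_inj) -sumrN /=; apply: eq_bigr => j _.
rewrite (weight_inv lW) // mulNr; congr (- (_ * _)).
rewrite /suffix_avg addrC; congr ((f _ + f _) / _); rewrite drop_winv subKn //.
  exact: red_winv_take.
exact: red_winv_take.
Qed.

Lemma touch_sum_le W s c f (M D : R) : touching W s c <= M ->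
  (forall x, `|f x| <= D) -> `|touch_sum W s c f| <= M * D.
Proof.
move=> TM fD; have D0 : 0 <= D by apply: le_trans (fD 1%g).
apply: le_trans (ler_wpM2r D0 TM); rewrite /touching mulr_suml.
apply: le_trans (ler_norm_sum _ _ _) _; apply: ler_sum => i _.
rewrite mulr_suml; apply: le_trans (ler_norm_sum _ _ _) _; apply: ler_sum => j _.
rewrite normrM ler_wpM2l // /suffix_avg normrM [X in _ * X]ger0_norm ?invr_ge0 //.
rewrite ler_pdivrMr // mulr_natr mulr2n.
by rewrite (le_trans (ler_normD _ _)) ?lerD.
Qed.

(* In the triangle [g = AB], [h = B^-1 C], [gh = AC], pieces inside [A] occur in
   [g] and [gh] with the same suffix values, pieces inside [C] occur in [h] and
   [gh], and pieces inside [B] occur with opposite signs in [g] and [h]: only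
   the pieces meeting the three cuts survive. *)
Lemma suffix_sum_triangle W (M D : R) g h (f : F -> R) :
  local_weight W -> touch_bounded W M -> (forall x, `|f x| <= D) ->
  `|suffix_sum W h f - suffix_sum W (g * h)%g f
    + suffix_sum W g (fun x => f (x * h)%g)| <= 3 * M * D.
Proof.
move=> lW tW fD; have [A [B [C [gE hE ghE]]]] := triangle g h.
have rg : reduced (A ++ B) by rewrite -gE word_reduced.
have rh : reduced (winv B ++ C) by rewrite -hE word_reduced.
have rgh : reduced (A ++ C) by rewrite -ghE word_reduced.
have rB := reduced_catr rg.
have hr : h = ((red B)^-1 * red C)%g.
  by rewrite -red_winv // -red_cat -hE red_word.
rewrite gE hE ghE !suffix_sum_cat // left_sum_winv // hr.
(* The translation by [h] cancels [B] and appends [C], so the [A] terms of [g] agree with those of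
   [gh], and the [B] terms of [g] with those of [h] up to sign. *)
have -> : left_sum W A (fun x => f (x * red B * ((red B)^-1 * red C))%g)
        = left_sum W A (fun x => f (x * red C)%g).
  by congr left_sum; apply/funext => x; rewrite !mulgA mulgK.
have -> : right_sum W B (fun x => f (x * ((red B)^-1 * red C))%g)
        = right_sum W B (fun x => f (x * (red B)^-1 * red C)%g).
  by congr right_sum; apply/funext => x; rewrite !mulgA.
rewrite (_ : _ + _ = touch_sum W (winv B ++ C) (size (winv B)) f
  - touch_sum W (A ++ C) (size A) f
  + touch_sum W (A ++ B) (size A) (fun x => f (x * ((red B)^-1 * red C))%g));
  last by ring.
have -> : 3 * M * D = M * D + M * D + M * D by ring.
have tc s t (f' : F -> R) : reduced (s ++ t) -> (forall x, `|f' x| <= D) ->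
    `|touch_sum W (s ++ t) (size s) f'| <= M * D.
  by move=> rst fD'; apply: touch_sum_le => //; apply: tW; rewrite // size_cat leq_addr.
rewrite (le_trans (ler_normD _ _)) ?lerD ?(le_trans (ler_normB _ _)) ?lerD ?tc //.
Qed.

Lemma suffix_sum_const W g (c : R) : suffix_sum W g (fun=> c) = weight_sum W g * c.
Proof.
rewrite /suffix_sum /weight_sum mulr_suml; apply: eq_bigr => i _.
by rewrite mulr_suml; apply: eq_bigr => j _; rewrite /suffix_avg; congr (_ * _); field.
Qed.

Lemma suffix_sumD W g (f1 f2 : F -> R) :
  suffix_sum W g (fun x => f1 x + f2 x) = suffix_sum W g f1 + suffix_sum W g f2.
Proof.
rewrite /suffix_sum -big_split; apply: eq_bigr => i _ /=; rewrite -big_split.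
by apply: eq_bigr => j _ /=; rewrite /suffix_avg; ring.
Qed.

(** This is the triangle estimate for the constant function 1. *)
Lemma delta1_weight_sum_le W (M : R) : local_weight W -> touch_bounded W M ->
  forall x, `|delta1 (weight_sum W) x| <= 3 * M.
Proof.
move=> lW tW x; have [g [h ->]] := tuple2E x; rewrite delta1E.
have := @suffix_sum_triangle W M 1 g h (fun=> 1) lW tW.
rewrite !suffix_sum_const !mulr1 => /(_ (fun=> _)) le.
rewrite (_ : _ - _ = weight_sum W h - weight_sum W (g * h)%g + weight_sum W g).
  by apply: le; rewrite normr1.
ring.
Qed.

(** The already corrected primitive, in the form bounded by [suffix_sum_triangle]; [cup_primitiveE]
    recovers the unbounded primitive plus the coboundary of [eta]. *)
Definition cup_primitive W (psi : F -> R) : cochain R F 3 := fun v =>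
  let x := tnth v ord0 in let y := tnth v (inord 1) in let z := tnth v (inord 2) in
  let omega a b := delta1 psi [tuple a; b] in
  suffix_sum W y (omega^~ z) - suffix_sum W (x * y)%g (omega^~ z)
  + suffix_sum W x (fun u => omega (u * y)%g z).

Lemma cup_primitiveE W psi x y z :
  let omega a b := delta1 psi [tuple a; b] in
  let eta g h := suffix_sum W g (omega^~ h) in
  cup_primitive W psi [tuple x; y; z] =
  weight_sum W x * omega y z
  + (eta y z - eta (x * y)%g z + eta x (y * z)%g - eta x y).
Proof.
move=> omega eta; rewrite /cup_primitive.
have -> : tnth [tuple x; y; z] (inord 1) = y by rewrite (tnth_nth x) /= inordK.
have -> : tnth [tuple x; y; z] (inord 2) = z by rewrite (tnth_nth x) /= inordK.
have -> : tnth [tuple x; y; z] ord0 = x by [].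
rewrite -/omega -suffix_sum_const.
(* The cocycle identity of [omega] at [(u, y, z)]. Summed over the suffixes [u] of [x], its term
   constant in [u] produces the factor [weight_sum W x]. *)
have -> : (fun u => omega (u * y)%g z) =
  (fun u => (omega y z + omega u (y * z)%g) + - omega u y).
  by apply/funext => u; have := delta1_cocycle psi u y z; rewrite /omega; lra.
rewrite (suffix_sumD W x (fun u => omega y z + omega u (y * z)%g)).
rewrite (suffix_sumD W x (fun=> omega y z)).
have -> : suffix_sum W x (fun u => - omega u y) = - eta x y.
  rewrite /eta /suffix_sum -sumrN; apply: eq_bigr => i _.
  by rewrite -sumrN; apply: eq_bigr => j _; rewrite /suffix_avg; ring.
rewrite /eta; ring.
Qed.

Lemma cup_primitiveP W psi :
  delta (cup_primitive W psi) = @cup R F 2 2 (delta1 (weight_sum W)) (delta1 psi).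
Proof.
apply/funext => x; have [a [b [c [d ->]]]] := tuple4E x.
rewrite delta3E cup22E !cup_primitiveE; cbv beta zeta.
rewrite [delta1 (weight_sum W) _]delta1E !mulgA.
(* The [eta] terms vanish, being a coboundary of a coboundary. By Leibniz the only other defect is
   [weight_sum W a] times the coboundary of [delta1 psi], which is zero. *)
have := delta1_cocycle psi b c d; rewrite ?mulgA => H.
have H' := congr1 ( *%R (weight_sum W a)) H; cbv beta in H'; rewrite mulr0 in H'.
rewrite -[RHS]subr0 -H'; ring.
Qed.

Lemma cup_primitive_le W psi (M D : R) : local_weight W -> touch_bounded W M ->
  (forall x, `|delta1 psi x| <= D) -> forall x, `|cup_primitive W psi x| <= 3 * M * D.
Proof.
move=> lW tW psiD x; rewrite /cup_primitive.
exact: (@suffix_sum_triangle W M D _ _ (fun u => delta1 psi [tuple u; tnth x (inord 2)])).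
Qed.

End Weights.

(** * Weights given by functions of subwords, and independent families *)

Section Pieces.
Variables (R : realType) (n : nat).
Local Notation F := (freeGroup n).
Local Notation letter := (letter n).
Implicit Types (g h : F) (s t : seq letter) (beta : F -> R).

Lemma sum_le_single (T : finType) (P : pred T) (X : T -> R) (B : R) :
  0 <= B -> (forall x, P x -> X x <= B) ->
  (forall x y, P x -> P y -> X x != 0 -> X y != 0 -> x = y) ->
  \sum_(x | P x) X x <= B.
Proof.
move=> B0 XB X1; have [x /andP[Px Xx]|X0] := pickP [pred x | P x & X x != 0].
  rewrite (bigD1 x) //= big1 ?addr0 ?XB // => y /andP[Py yx].
  by apply/eqP/negPn/negP => Xy; move: yx; rewrite (X1 y x) ?eqxx.
by rewrite big1 // => x Px; have := X0 x; rewrite /= Px /= => /negbFE/eqP->.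
Qed.

(* A cut is crossed or ended at by at most one piece, and at most one other
   piece starts there. *)
Lemma touching_disjoint (W : seq letter -> nat -> nat -> R) (B : R) s c :
  0 <= B -> (forall i j, `|W s i j| <= B) ->
  (forall i j, ~~ (i < j)%N -> W s i j = 0) ->
  (forall i j i' j', (j <= size s)%N -> (j' <= size s)%N ->
     W s i j != 0 -> W s i' j' != 0 -> (i' < j)%N -> (i < j')%N ->
     i = i' /\ j = j') ->
  touching W s c <= 2 * B.
Proof.
move=> B0 WB W0 Wd; rewrite /touching pair_big_dep /=.
(* Nonzero pieces starting before [c] all contain the letter to its left, and those starting at [c]
   the letter to its right; each class thus has at most one member. *)
rewrite (bigID (fun p : 'I_(size s).+1 * 'I_(size s).+1 => p.1 < c)%N) /=.
have Wlt i j : W s i j != 0 -> (i < j)%N.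
  by move=> Wij; apply/negPn/negP => /W0 e; rewrite e eqxx in Wij.
have jle (j : 'I_(size s).+1) : (j <= size s)%N by rewrite -ltnS.
rewrite mulr_natl mulr2n lerD //; apply: sum_le_single => //.
- move=> [i j] [i' j'] /= /andP[/andP[ic cj] lt] /andP[/andP[ic' cj'] lt'].
  rewrite !normr_eq0 => nz nz'.
  have [||e1 e2] := Wd _ _ _ _ (jle j) (jle j') nz nz'.
  + exact: leq_trans lt' cj.
  + exact: leq_trans lt cj'.
  + by congr pair; apply: val_inj.
- move=> [i j] [i' j'] /= /andP[/andP[ic cj] lt] /andP[/andP[ic' cj'] lt'].
  rewrite !normr_eq0 => nz nz'.
  have [||e1 e2] := Wd _ _ _ _ (jle j) (jle j') nz nz'.
  + by have := Wlt _ _ nz; move: lt lt'; lia.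
  + by have := Wlt _ _ nz'; move: lt lt'; lia.
  + by congr pair; apply: val_inj.
Qed.

Definition piece s i j := take (j - i) (drop i s).

(** Every nonempty subword occurrence is a piece, so the weight sum adds [beta] over all of them,
    overlapping ones included. *)
Definition piece_weight beta s i j : R :=
  if (i < j)%N then beta (red (piece s i j)) else 0.

Lemma size_piece s i j : (j <= size s)%N -> size (piece s i j) = (j - i)%N.
Proof. by move=> js; rewrite size_takel // size_drop leq_sub2r. Qed.

Lemma piece_catl s t i j : (i < j)%N -> (j <= size s)%N ->
  piece (s ++ t) i j = piece s i j.
Proof.
move=> ij js; have is_ : (i < size s)%N by lia.
rewrite /piece drop_cat is_ takel_cat // size_drop; lia.
Qed.

Lemma piece_catr s t i j : piece (s ++ t) (size s + i) (size s + j) = piece t i j.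
Proof. by rewrite /piece subnDl drop_cat ltnNge leq_addr /= addKn. Qed.

Lemma piece_winv s i j : (i < j)%N -> (j <= size s)%N ->
  piece (winv s) (size s - j) (size s - i) = winv (piece s i j).
Proof.
move=> ij js; rewrite /piece drop_winv subKn // take_winv size_takel //.
rewrite (_ : _ - _ = i)%N; last by lia.
by rewrite take_drop subnK // ltnW.
Qed.

Lemma reduced_piece s i j : reduced s -> reduced (piece s i j).
Proof. by move=> rs; apply/reduced_take/reduced_drop. Qed.

Lemma local_piece_weight beta : Defs.alternating beta -> local_weight (piece_weight beta).
Proof.
move=> alt; split=> [s i j /negPf|s t i j js|s t i j i0|s i j rs is_ js].
- by rewrite /piece_weight => ->.
- by rewrite /piece_weight; case: ifP => // ij; rewrite piece_catl // ltnW.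
- by rewrite /piece_weight ltn_add2l; case: ifP => // ij; rewrite piece_catr.
- rewrite /piece_weight (_ : (_ - _ < _ - _)%N = (i < j)%N); last by lia.
  case: ifP => ij; last by rewrite oppr0.
  by rewrite piece_winv // red_winv ?reduced_piece // alt.
Qed.

Lemma piece_cat s i j k : (i <= j)%N -> (j <= k)%N ->
  piece s i k = piece s i j ++ piece s j k.
Proof.
move=> ij jk; rewrite /piece (_ : k - i = (j - i) + (k - j))%N; last by lia.
by rewrite takeD drop_drop subnK.
Qed.

Lemma red_piece_neq1 s i j : reduced s -> (i < j)%N -> (j <= size s)%N ->
  red (piece s i j) <> 1%g.
Proof.
move=> rs ij js /(congr1 (fun x : F => size (word x))).
rewrite word_red ?reduced_piece // size_piece //=; lia.
Qed.

(** Distinct pieces sharing a letter are nested, giving a proper subword, or staggered, giving a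
    proper overlap; independence forbids both. *)
Lemma independent_piece (I : set F) s i j i' j' : independent I -> reduced s ->
  (j <= size s)%N -> (j' <= size s)%N -> (i < j')%N -> (i' < j)%N ->
  (i < j)%N -> (i' < j')%N ->
  I (red (piece s i j)) -> I (red (piece s i' j')) -> i = i' /\ j = j'.
Proof.
wlog: i j i' j' / ((i < i') || (i == i') && (j <= j'))%N.
  move=> H indI rs js js' ij' ij lt lt' Iij Iij'.
  have [C|C] := boolP ((i < i') || (i == i') && (j <= j'))%N; first exact: H.
  have [|e1 e2] := H i' j' i j _ indI rs js' js ij ij' lt' lt Iij' Iij; last by [].
  lia.
move=> C indI rs js js' ij' i'j lt lt' Iij Iij'.
have nested a b c d : (a <= b)%N -> (b < c)%N -> (c <= d)%N -> (d <= size s)%N ->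
    (a, d) <> (b, c) -> overlap (red (piece s a d)) (red (piece s b c)).
  move=> ab bc cd ds ne; apply: Or33; split.
    rewrite !word_red ?reduced_piece // (@piece_cat s a b d) //; last by lia.
    rewrite (@piece_cat s b c d) //; last by lia.
    exact: infix_infix.
  move=> /(congr1 (fun x : F => size (word x))).
  rewrite !word_red ?reduced_piece // !size_piece //; last by lia.
  by move=> e; apply: ne; congr pair; lia.
have [ii'|ii'] := eqVneq i i'.
  subst i'; split=> //; apply/eqP/negPn/negP => jj'.
  apply: (indI _ _ Iij' Iij); apply: nested => //; try lia.
  by move=> [e]; rewrite e eqxx in jj'.
have {C} lt1 : (i < i')%N by move: C; rewrite (negPf ii') orbF.
have [j'j|jj'] := leqP j' j.
  by case: (indI _ _ Iij Iij'); apply: nested => //; [lia|move=> [e]; lia].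
case: (indI _ _ Iij Iij'); apply: Or31; left.
(* Staggered case [i < i' < j < j']: the common part lies between [i'] and [j]. *)
exists (red (piece s i i')), (red (piece s i' j)), (red (piece s j j')).
rewrite !word_red ?reduced_piece //; split; first by split; apply: red_piece_neq1; lia.
by split; apply: piece_cat; lia.
Qed.

Lemma piece_touching_independent (I : set F) beta s c : independent I ->
  supported_on I beta -> bounded beta -> reduced s ->
  touching (piece_weight beta) s c <= 2 * fine (supnorm beta).
Proof.
move=> indI sI /boundedP[M bM] rs.
have fin : supnorm beta \is a fin_num.
  rewrite fin_numE -ltey -ltNye (lt_le_trans _ (ler_supnorm beta 1%g)) ?ltNyr //.
  by apply/boundedP; exists M.
have le x : `|beta x| <= fine (supnorm beta) by rewrite -lee_fin fineK // ler_supnorm.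
have B0 : 0 <= fine (supnorm beta) by apply: le_trans (le 1%g).
apply: touching_disjoint => //.
- by move=> i j; rewrite /piece_weight; case: ifP; rewrite ?normr0.
- by move=> i j /negPf; rewrite /piece_weight => ->.
move=> i j i' j' js js'; rewrite /piece_weight.
case: ifP => [ij|]; rewrite ?eqxx //; case: ifP => [ij'|]; rewrite ?eqxx //.
move=> nz nz' i'j ij'2.
have Iof x : beta x != 0 -> I x.
  by move=> bx; apply: contrapT => nI; rewrite sI ?eqxx // in bx.
by apply: (independent_piece indI rs) => //; apply: Iof.
Qed.

End Pieces.

(** * Brooks quasimorphisms and their sums as weight sums *)

Section BrooksSums.
Variables (R : realType) (n : nat).
Local Notation F := (freeGroup n).
Implicit Types (g u w : F).

Definition signed_indicator w u : R := (u == w)%:R - (u == w^-1%g)%:R.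

Lemma alternating_signed_indicator w : Defs.alternating (signed_indicator w).
Proof.
move=> u; rewrite /signed_indicator opprB; congr (_%:R - _%:R).
  by rewrite -[u in RHS]invgK (inj_eq invg_inj) ?invgK (can2_eq invgK invgK).
by rewrite (inj_eq invg_inj).
Qed.

(** From a starting cut [i], only the end [i + size w] can give the piece [w]. The empty word is
    excluded because empty pieces weigh zero although it occurs at every cut. *)
Lemma occurrencesE w g : w <> 1%g -> (occurrences w g)%:R =
  weight_sum (piece_weight (fun u => (u == w)%:R : R)) g.
Proof.
move=> w1; rewrite /occurrences -sum1_count big_mkcond natr_sum.
rewrite (_ : iota 0 _ = index_iota 0 (size g).+1) ?big_mkord; last by rewrite /index_iota subn0.
 apply: eq_bigr => i _.
have w0 : (0 < size w)%N.
  rewrite lt0n size_eq0; apply/eqP => e; apply: w1; exact: val_inj.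
have rg := word_reduced g.
rewrite prefixE; case: eqP => [tk|ntk].
  have iw : (i + size w < (size g).+1)%N.
    move/(congr1 size): tk; rewrite size_take size_drop; case: ltnP => [|_ <-].
      by rewrite ltn_subRL ltnS => /ltnW.
    by rewrite subnKC // -ltnS.
  rewrite (bigD1 (Ordinal iw)) //= big1 => [|j ji].
    by rewrite /piece_weight -{1}[val i]addn0 ltn_add2l w0 /piece addKn tk red_word eqxx addr0.
  rewrite /piece_weight; case: ifP => // ij; case: eqP => // e.
  case/negP: ji; apply/eqP/val_inj; move/(congr1 (size \o word (n:=n))): e => /=.
  by rewrite foldr_push_reduced ?reduced_piece // size_piece; have := ltn_ord j; lia.
rewrite big1 // => j _; rewrite /piece_weight; case: ifP => // ij; case: eqP => // e.
case: ntk; rewrite -[in RHS]e word_red ?reduced_piece // /piece; congr take.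
by rewrite -e word_red ?reduced_piece // size_piece // -ltnS.
Qed.

Lemma brooks1 g : brooks R 1%g g = 0.
Proof. by rewrite /brooks invg1 subrr. Qed.

Lemma brooksE w g : w <> 1%g ->
  brooks R w g = weight_sum (piece_weight (signed_indicator w)) g.
Proof.
move=> w1; rewrite /brooks !occurrencesE //; last first.
  by move=> /(congr1 (fun x : F => x^-1%g)); rewrite invgK invg1.
rewrite /weight_sum -sumrB; apply: eq_bigr => i _; rewrite -sumrB.
by apply: eq_bigr => j _; rewrite /piece_weight; case: ifP; rewrite ?subr0.
Qed.

Lemma sum_mul_indicator (r : seq F) (alpha : F -> R) x : uniq r ->
  \sum_(w <- r) alpha w * (w == x)%:R = if x \in r then alpha x else 0.
Proof.
move=> ur; case: ifP => xr.
  rewrite (bigD1_seq x) //= eqxx mulr1 big1 ?addr0 // => w /negPf->.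
  by rewrite mulr0.
rewrite big_seq big1 // => w wr; case: eqP => [wx|]; last by rewrite mulr0.
by rewrite -wx wr in xr.
Qed.

(** Each piece [x] of [g] contributes [alpha x], either directly when [x] is in [Np], or as minus
    [alpha] of its inverse when the inverse is. *)
Lemma brooks_sumE (Np : set F) (alpha : F -> R) g :
  half_system Np -> Defs.alternating alpha ->
  supported_on (@non_self_overlapping n) alpha ->
  brooks_sum Np alpha g = weight_sum (piece_weight alpha) g.
Proof.
move=> [NpN Np1] alt sup.
pose u (p : 'I_(size g).+1 * 'I_(size g).+1) := red (piece g p.1 p.2).
pose r0 := [seq u p | p : 'I_(size g).+1 * 'I_(size g).+1].
pose r1 := undup (r0 ++ [seq x^-1%g | x <- r0]).
(* [Np] may contain the identity, which overlaps nothing; it is removed here, its Brooks function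
   being zero. *)
pose r := [seq w <- r1 | (w \in Np) && (w != 1%g)].
have mem_r w : w \in r -> Np w by rewrite mem_filter => /andP[/andP[/set_mem]].
have r_neq1 w : w \in r -> w <> 1%g.
  by rewrite mem_filter => /andP[/andP[_ /eqP]].
have r_uniq : uniq r by rewrite filter_uniq // undup_uniq.
have in_r i j : (u (i, j) \in r1) && ((u (i, j))^-1%g \in r1).
  have ur : u (i, j) \in r0 by apply/mapP; exists (i, j); rewrite ?mem_enum.
  by rewrite !mem_undup !mem_cat ur (map_f (fun x : F => x^-1%g) ur) orbT.
rewrite /brooks_sum (fsbigE r) //=; last first.
- move=> w Npw wr; have [->|/eqP w1] := eqVneq w 1%g.
    by rewrite brooks1 mulr0.
  rewrite brooksE // /weight_sum big1 ?mulr0 // => i _; rewrite big1 // => j _.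
  rewrite /piece_weight; case: ifP => // _; rewrite /signed_indicator.
  have /andP[u1 u2] := in_r i j.
  have nr x : x \in r1 -> x == w = false.
    move=> xr; apply/eqP => e; move: wr; rewrite -e mem_filter xr andbT e.
    by rewrite mem_set //; case: eqP w1.
  by rewrite (nr _ u1) -(inj_eq invg_inj) invgK (nr _ u2) subrr.
rewrite big_seq_cond (eq_bigl (fun w => w \in r)); last first.
  by move=> w; case wr: (w \in r) => //=; apply/mem_set/mem_r.
transitivity (\sum_(w <- r | w \in r) \sum_(i < (size g).+1) \sum_(j < (size g).+1)
    alpha w * piece_weight (signed_indicator w) g i j).
  apply: eq_bigr => w wr; rewrite brooksE ?mulr_sumr; last exact: r_neq1.
  by apply: eq_bigr => i _; rewrite mulr_sumr.
rewrite exchange_big /=; apply: eq_bigr => i _.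
rewrite exchange_big /=; apply: eq_bigr => j _.
rewrite /piece_weight; case: ifP => ij; last by rewrite big1 // => *; rewrite mulr0.
rewrite -big_seq; have /andP[ur uVr] := in_r i j.
set x := red _.
have x1 : x <> 1%g by apply: red_piece_neq1; rewrite ?word_reduced // -ltnS.
have xV1 : x^-1%g <> 1%g by move=> /(congr1 (fun x : F => x^-1%g)); rewrite invgK invg1.
have in_rE y : y \in r1 -> y <> 1%g -> (y \in r) = (y \in Np).
  by move=> yr /eqP y1; rewrite mem_filter yr y1 !andbT.
rewrite (eq_bigr (fun w => alpha w * (w == x)%:R - alpha w * (w == x^-1%g)%:R)).
  rewrite sumrB !sum_mul_indicator // !in_rE //.
  (* If [x] is not self-overlapping, exactly one of [x] and its inverse is in [Np]; otherwise
     [alpha] vanishes at both. *)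
  have [Nx|Nx] := pselect (@non_self_overlapping n x).
    have [[/mem_set -> nV]|[nx /mem_set ->]] := Np1 _ Nx x1.
      by rewrite memNset // subr0.
    by rewrite memNset // alt opprK add0r.
  by rewrite alt sup // oppr0 !if_same subr0.
move=> w _; rewrite /signed_indicator mulrBr [x == w]eq_sym; congr (_ - _ * _%:R).
by rewrite -(inj_eq invg_inj) invgK eq_sym.
Qed.

End BrooksSums.

(** * Bounds on the weights meeting a cut, for Brooks functions and their sums *)

Section TouchBounds.
Variables (R : realType) (n : nat).
Local Notation F := (freeGroup n).
Implicit Types (g u w : F).

(** Pieces of nonzero weight have length [size w], so those touching [c] start at one of
    [size w + 1] cuts. The bound 2 on each is crude: it only serves to make the defect finite. *)
Lemma touch_bounded_signed_indicator w :
  touch_bounded (piece_weight (signed_indicator R w)) ((size w).+1%:R * 2).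
Proof.
move=> s c rs cs; rewrite /touching.
(* [b i] is 2 if a piece of length [size w] starting at [i] touches [c], else 0; as a sum over [k],
   it leaves at most one [i] per [k] after exchange. *)
pose b (i : nat) : R := \sum_(k < (size w).+1) ((i + k)%N == c)%:R * 2.
have b0 i : 0 <= b i by apply: sumr_ge0 => k _; rewrite mulr_ge0.
have sz i j : (j <= size s)%N -> piece_weight (signed_indicator R w) s i j != 0 ->
    j = (i + size w)%N.
  move=> js; rewrite /piece_weight; case: ifP => ij; rewrite ?eqxx //.
  have szp : size (word (red (piece s i j))) = (j - i)%N.
    by rewrite word_red ?reduced_piece // size_piece.
  rewrite /signed_indicator; case: (red _ =P w) => [e _|_].
    by rewrite e in szp; rewrite szp subnKC // ltnW.
  case: (red _ =P _) => [e _|_]; last by rewrite subrr eqxx.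
  by rewrite e word_inv size_winv in szp; rewrite szp subnKC // ltnW.
apply: (@le_trans _ _ (\sum_(i < (size s).+1) b i)).
  apply: ler_sum => i _; apply: sum_le_single => // [j /andP[ic cj]|j j' _ _].
    have [->|nz] := eqVneq (piece_weight (signed_indicator R w) s i j) 0.
      by rewrite normr0.
    have jE := sz _ _ (ltn_ord j) nz.
    have kw : (c - i < (size w).+1)%N by rewrite ltnS leq_subLR -jE.
    rewrite /b (bigD1 (Ordinal kw)) //= subnKC // eqxx mul1r.
    apply: (@le_trans _ _ 2); last first.
      by rewrite lerDl sumr_ge0 // => k _; rewrite mulr_ge0.
    rewrite /piece_weight; case: ifP => _; rewrite ?normr0 // /signed_indicator.
    by case: eqP => _; case: eqP => _; rewrite ?subrr ?subr0 ?sub0r ?normrN ?normr0 ?normr1 ?ler1n.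
  rewrite !normr_eq0 => /(sz _ _ (ltn_ord j)) jE /(sz _ _ (ltn_ord j')) jE'.
  by apply: val_inj; rewrite /= jE jE'.
have -> : (size w).+1%:R * 2 = \sum_(k < (size w).+1) (2 : R).
  by rewrite sumr_const card_ord mulr_natl.
rewrite /b exchange_big /=; apply: ler_sum => k _; apply: sum_le_single => // [i _|i i' _ _].
  by case: eqP; rewrite ?mul1r ?mul0r.
case: ((i + k)%N =P c) => [e|_]; rewrite ?mul0r ?eqxx //.
case: ((i' + k)%N =P c) => [e' _ _|_]; rewrite ?mul0r ?eqxx //.
by apply: val_inj; apply: (@addIn k); rewrite e e'.
Qed.

Lemma bounded_delta1_brooks w : w <> 1%g -> bounded (delta1 (brooks R w)).
Proof.
move=> w1; have -> : brooks R w = weight_sum (piece_weight (signed_indicator R w)).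
  by apply/funext => g; rewrite brooksE.
apply/boundedP; eexists; apply: delta1_weight_sum_le.
  exact/local_piece_weight/alternating_signed_indicator.
exact: touch_bounded_signed_indicator.
Qed.

Lemma supnorm_ge0 (f : F -> R) : (0 <= supnorm f)%E.
Proof. by apply: le_trans (ler_supnorm f 1%g); rewrite lee_fin. Qed.

Lemma touching_ge0 W (s : seq (letter n)) c : 0 <= touching W s c :> R.
Proof. by apply: sumr_ge0 => i _; apply: sumr_ge0. Qed.

(** Each independent term contributes at most twice its norm at a cut. Dividing by 2 leaves the
    plain sum of norms, so that the bound passes to the infimum [SInd]. *)
Lemma touching_decomposition (alpha : F -> R) a (s : seq (letter n)) c :
  ind_decomposition alpha a -> reduced s ->
  ((touching (piece_weight alpha) s c / 2)%:E <= \sum_(0 <= i <oo) supnorm (a i))%E.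
Proof.
move=> [indI ba cvga fina] rs.
have S0 : (0 <= \sum_(0 <= i <oo) supnorm (a i))%E.
  by apply: nneseries_ge0 => *; apply: supnorm_ge0.
have Sfin : (\sum_(0 <= i <oo) supnorm (a i))%E \is a fin_num by rewrite ge0_fin_numE.
have afin i : supnorm (a i) \is a fin_num.
  by rewrite ge0_fin_numE ?supnorm_ge0 //; case: (ba i).
rewrite -(fineK Sfin) lee_fin ler_pdivrMr // mulrC.
pose part N w := series (fun i => a i w) N.
(* [touching] is a finite sum of absolute values, so pointwise convergence of the partial sums is
   enough. *)
have cvgT : touching (piece_weight (part N)) s c @[N --> \oo] -->
    touching (piece_weight alpha) s c.
  apply: cvg_big => [|i _]; first exact: add_continuous.
  apply: cvg_big => [|j _]; first exact: add_continuous.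
  apply: cvg_norm; rewrite /piece_weight; case: ifP => _; last exact: cvg_cst.
  exact: cvga.
apply: (cvgr_to_le cvgT); apply: nearW => N.
have step : touching (piece_weight (part N)) s c <=
    \sum_(0 <= i < N) touching (piece_weight (a i)) s c.
  rewrite /touching exchange_big /=; apply: ler_sum => i _.
  rewrite exchange_big /=; apply: ler_sum => j _.
  rewrite /piece_weight; case: ifP => _; last by rewrite normr0 sumr_ge0.
  exact: ler_norm_sum.
apply: (le_trans step); apply: (@le_trans _ _ (\sum_(0 <= i < N) 2 * fine (supnorm (a i)))).
  apply: ler_sum => i _; have [I [indepI _ supI]] := indI i.
  by apply: piece_touching_independent indepI supI _ rs; case: (ba i).
rewrite -mulr_sumr ler_pM2l // -lee_fin fineK // -sumEFin.
rewrite (eq_bigr (fun i => supnorm (a i))) => [|i _]; last by rewrite fineK.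
by apply: nneseries_lim_ge => *; apply: supnorm_ge0.
Qed.

Lemma SInd_touching (alpha : F -> R) (s : seq (letter n)) c : reduced s ->
  ((touching (piece_weight alpha) s c / 2)%:E <= SInd alpha)%E.
Proof.
move=> rs; apply: le_ereal_inf_tmp => _ [a da <-].
exact: touching_decomposition.
Qed.

Lemma SInd_fin (alpha : F -> R) : l1Ind alpha -> SInd alpha \is a fin_num.
Proof.
move=> [_ _ [a da]]; rewrite ge0_fin_numE.
  case: (da) => _ _ _; apply: le_lt_trans; apply: ereal_inf_lbound; by exists a.
apply: le_trans (SInd_touching alpha 0 (isT : reduced (n := n) [::])).
by rewrite lee_fin divr_ge0 ?touching_ge0.
Qed.

Lemma touch_bounded_l1Ind (alpha : F -> R) : l1Ind alpha ->
  touch_bounded (piece_weight alpha) (2 * fine (SInd alpha)).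
Proof.
move=> la s c rs _; rewrite mulrC -ler_pdivrMr // -lee_fin fineK ?SInd_fin //.
exact: SInd_touching.
Qed.

End TouchBounds.

(** * Rolli quasimorphisms as weight sums over maximal syllables *)

Section RolliWeights.
Variables (R : realType) (n : nat) (lambda : 'I_n -> int -> R).
Local Notation F := (freeGroup n).
Local Notation letter := (letter n).
Implicit Types (g : F) (s t : seq letter) (a b : letter).

(** Syllables are described by their cuts, which makes locality and inversion visible. Past the end
    [onth] is [None], so the end of the word closes a run; at [i = 0] the predecessor is 0 again,
    hence the guard. *)
Definition maximal_run s a (i j : nat) : Prop :=
  [/\ (i < j)%N, forall k, (i <= k < j)%N -> onth s k = Some a,
      (0 < i)%N -> onth s i.-1 <> Some a & onth s j <> Some a].

Definition run_value a (m : nat) : R := lambda a.1 (if a.2 then - m%:Z else m%:Z).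

(** At most one letter has a run between given cuts; summing over letters avoids choosing it. *)
Definition rolli_weight s i j : R :=
  \sum_a if `[< maximal_run s a i j >] then run_value a (j - i) else 0.

(** Maximality reads the letter at index [j], hence the strict inequality. *)
Lemma maximal_run_catl s t a i j : (j < size s)%N ->
  maximal_run (s ++ t) a i j <-> maximal_run s a i j.
Proof.
move=> js; have E k : (k <= j)%N -> onth (s ++ t) k = onth s k.
  by move=> kj; rewrite onth_cat (leq_ltn_trans kj js).
split=> -[ij r1 r2 r3]; split=> //.
- by move=> k kij; rewrite -E ?r1 //; lia.
- by rewrite -E //; lia.
- by rewrite -E.
- by move=> k kij; rewrite E ?r1 //; lia.
- by rewrite E //; lia.
- by rewrite E.
Qed.

Lemma maximal_run_catr s t a i j : (0 < i)%N ->
  maximal_run (s ++ t) a (size s + i) (size s + j) <-> maximal_run t a i j.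
Proof.
move=> i0; have E k : onth (s ++ t) (size s + k) = onth t k.
  by rewrite onth_cat ltnNge leq_addr /= addKn.
have P : (size s + i).-1 = (size s + i.-1)%N by lia.
rewrite /maximal_run E P E ltn_add2l; split=> -[ij r1 r2 r3]; split=> //.
- by move=> k kij; rewrite -E r1 //; lia.
- by move=> _; apply: r2; lia.
- move=> k kij; rewrite (_ : k = size s + (k - size s))%N ?E ?r1 //; lia.
- by move=> _; apply: r2.
Qed.

Lemma onth_winv s k : (k < size s)%N ->
  onth (winv s) k = omap (@linv n) (onth s (size s - k.+1)).
Proof.
move=> ks; have a : letter by case: (s) ks.
have lt : (size s - k.+1 < size s)%N by lia.
have onthS t l : (l < size t)%N -> onth t l = Some (nth a t l).
  by move=> lt'; rewrite onthE (nth_map a).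
rewrite !onthS ?size_winv //= /winv nth_rev ?size_map // (nth_map a) //.
Qed.

Lemma maximal_run_winv s a i j : (j <= size s)%N -> maximal_run s a i j ->
  maximal_run (winv s) (linv a) (size s - j) (size s - i).
Proof.
move=> js [ij r1 r2 r3].
have linv_Some (o : option letter) : o <> Some a -> omap (@linv n) o <> Some (linv a).
  by move=> oa e; apply: oa; apply: (inj_omap (can_inj (@linvK n))).
split=> [|k kij|js0|]; first lia.
- by rewrite onth_winv ?r1 //; lia.
- rewrite onth_winv; last lia.
  by rewrite (_ : _ - _ = j)%N; [exact: linv_Some | lia].
- case: i ij r1 r2 => [|i] ij r1 r2; first by rewrite subn0 onth_default ?size_winv.
  rewrite onth_winv; last lia.
  by rewrite (_ : _ - _ = i)%N; [apply: linv_Some; exact: r2 | lia].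
Qed.

Hypothesis alt : forall i, alternatingZ (lambda i).

Lemma run_value_linv a m : run_value (linv a) m = - run_value a m.
Proof. by case: a => i [] /=; rewrite /run_value /= alt ?opprK. Qed.

Lemma local_rolli_weight : local_weight rolli_weight.
Proof.
split=> [s i j ij|s t i j js|s t i j i0|s i j rs si sj].
- by rewrite /rolli_weight big1 // => a _; case: asboolP => // -[]; rewrite (negPf ij).
- by apply: eq_bigr => a _; rewrite (asbool_equiv_eq (maximal_run_catl t a i js)).
- apply: eq_bigr => a _; rewrite (asbool_equiv_eq (maximal_run_catr s t a j i0)).
  by rewrite subnDl.
rewrite /rolli_weight (reindex_inj (can_inj (@linvK n))) -sumrN /=.
apply: eq_bigr => a _; rewrite (_ : size s - i - _ = j - i)%N; last by lia.
have -> : `[< maximal_run (winv s) (linv a) (size s - j) (size s - i) >] =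
          `[< maximal_run s a i j >].
  apply: asbool_equiv_eq; split=> [rn|]; last exact: maximal_run_winv.
  have := maximal_run_winv _ rn; rewrite size_winv leq_subr => /(_ isT).
  by rewrite winvK linvK !subKn.
by case: ifP => _; rewrite ?oppr0 // run_value_linv.
Qed.

(** The common letter at the larger starting cut forces [a = b]; if ends differed, one run would
    extend past an end of the other. *)
Lemma maximal_run_disjoint s a b i j i' j' : maximal_run s a i j ->
  maximal_run s b i' j' -> (i' < j)%N -> (i < j')%N ->
  [/\ a = b, i = i' & j = j'].
Proof.
move=> [ij r1 r2 r3] [ij' q1 q2 q3] i'j ij'2.
have ab : a = b.
  have := r1 (maxn i i'); have := q1 (maxn i i').
  rewrite leq_maxr leq_maxl !gtn_max ij i'j ij' ij'2 /= => -> // /(_ isT).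
  by case.
subst b; split=> //.
  have [lt|lt|//] := ltngtP i i'.
    by case: q2; [lia | apply: r1; lia].
  by case: r2; [lia | apply: q1; lia].
have [lt|lt|//] := ltngtP j j'.
  by case: r3; apply: q1; lia.
by case: q3; apply: r1; lia.
Qed.

Hypothesis bl : forall i, bounded (lambda i).

Lemma rolli_norm_ge0 : (0 <= rolli_norm lambda)%E.
Proof. by apply: bigmax_ge_id. Qed.

Lemma rolli_norm_fin : rolli_norm lambda \is a fin_num.
Proof.
rewrite ge0_fin_numE ?rolli_norm_ge0 //.
by apply: bigmax_lt => [|i _]; [exact: ltry | exact: bl].
Qed.

Lemma run_value_le a m : `|run_value a m| <= fine (rolli_norm lambda).
Proof.
rewrite -lee_fin fineK ?rolli_norm_fin //.
apply: le_trans (le_bigmax _ (fun i => supnorm (lambda i)) a.1).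
exact: ler_supnorm.
Qed.

Lemma rolli_weight_eq s a i j : maximal_run s a i j ->
  rolli_weight s i j = run_value a (j - i).
Proof.
move=> rn; rewrite /rolli_weight (bigD1 a) //= asboolT // big1 ?addr0 // => b ba.
have [ij _ _ _] := rn; case: asboolP => // rnb.
have [e _ _] := maximal_run_disjoint rn rnb ij ij.
by rewrite e eqxx in ba.
Qed.

Lemma rolli_weight_neq0 s i j : rolli_weight s i j != 0 ->
  exists a, maximal_run s a i j.
Proof.
move=> nz; apply: contrapT => nr; move: nz; rewrite /rolli_weight big1 ?eqxx // => a _.
by case: asboolP => // ra; case: nr; exists a.
Qed.

Lemma touch_bounded_rolli : touch_bounded rolli_weight (2 * fine (rolli_norm lambda)).
Proof.
move=> s c rs cs; have N0 : 0 <= fine (rolli_norm lambda) by rewrite fine_ge0 ?rolli_norm_ge0.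
apply: touching_disjoint => // [i j|i j|i j i' j' _ _].
- have [->|/rolli_weight_neq0[a /rolli_weight_eq->]] := eqVneq (rolli_weight s i j) 0.
    by rewrite normr0.
  exact: run_value_le.
- exact: weight_supp local_rolli_weight _ _ _.
- move=> /rolli_weight_neq0[a ra] /rolli_weight_neq0[b rb] i'j ij'.
  by have [] := maximal_run_disjoint ra rb i'j ij'.
Qed.

(** The prefixed block is one whole run, the only one starting before the cut [m]; the remaining
    runs are those of [s]. *)
Lemma rolli_weight_sum_nseq m a s : (0 < m)%N -> onth s 0 <> Some a ->
  let u := nseq m a ++ s in
  \sum_(i < (size u).+1) \sum_(j < (size u).+1) rolli_weight u i j =
  run_value a m + \sum_(i < (size s).+1) \sum_(j < (size s).+1) rolli_weight s i j.
Proof.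
move=> m0 sa u; rewrite /u size_cat size_nseq -addnS.
have uL k : (k < m)%N -> onth u k = Some a.
  by move=> km; rewrite /u onth_cat size_nseq km onth_nseq km.
have uR k : onth u (m + k) = onth s k.
  by rewrite /u onth_cat size_nseq ltnNge leq_addr /= addKn.
have run0 : maximal_run u a 0 m.
  by split=> //; rewrite -[m]addn0 uR.
rewrite big_split_ord /=; congr (_ + _).
- have mlt : (m < m + (size s).+1)%N by rewrite addnS ltnS leq_addr.
  rewrite pair_big (bigD1 (Ordinal m0, Ordinal mlt)) //= (rolli_weight_eq run0) subn0.
  rewrite [X in _ + X]big1 ?addr0 // => -[i j] /= ij.
  apply/eqP/negPn/negP.
  move=> /rolli_weight_neq0[b rb]; have [lt _ _ _] := rb.
  have [_ i0 jm] := maximal_run_disjoint run0 rb (ltn_ord i) (leq_ltn_trans (leq0n _) lt).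
  by case/negP: ij; apply/eqP; congr pair; apply: val_inj.
- apply: eq_bigr => i _; rewrite big_split_ord /= big1 ?add0r => [|j _]; last first.
    by apply: (weight_supp local_rolli_weight); have := ltn_ord j; lia.
  apply: eq_bigr => j _.
  (* Locality does not cover runs starting at the junction; there the preceding letter [a] differs
     from the first letter of [s], so maximality is unchanged. *)
  have [i0|i0] := posnP (i : nat); last first.
    by have := weight_catr local_rolli_weight (nseq m a) s j i0; rewrite size_nseq => ->.
  rewrite i0 addn0 /rolli_weight; apply: eq_bigr => b _; rewrite addKn subn0.
  congr (if _ then _ else _); apply: asbool_equiv_eq; split=> -[j0 r1 r2 r3].
    split=> // [|k kj|]; [lia | rewrite -uR r1 //; lia | by rewrite -uR].
  split=> [|k kj|_|]; [lia | | | by rewrite uR].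
    rewrite (_ : k = m + (k - m))%N ?uR ?r1 //; lia.
  rewrite uL; last lia.
  by move=> [ab]; apply: sa; rewrite ab; apply: r1.
Qed.

Lemma rolli_weight_sum g : rolli lambda g = weight_sum rolli_weight g.
Proof.
have [srt nz gE] := syllablesP g; rewrite /rolli.
have -> : weight_sum rolli_weight g =
    let u := flatten (map (@power_word n) (syllables g)) in
    \sum_(i < (size u).+1) \sum_(j < (size u).+1) rolli_weight u i j by rewrite gE.
elim: (syllables g) srt nz => [|p t IHt] /= srt nz.
  by rewrite big_nil !big_ord_recl !big_ord0 !addr0 (weight_supp local_rolli_weight).
have {nz}/andP[p0 nz] := nz.
rewrite big_cons IHt //; last exact: path_sorted srt.
rewrite [power_word p]/power_word rolli_weight_sum_nseq.
- by congr (_ + _); rewrite /run_value /=; congr lambda; case: (p.2) => k /=; rewrite ?NegzE.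
- by rewrite absz_gt0.
(* Consecutive syllables have distinct basis elements, so the next one cannot start with the letter
   of [p]. *)
case: t srt nz {IHt} => [//|q t] /andP[pq _] /andP[q0 _].
rewrite [flatten _]/(nseq _ _ ++ flatten _) onth_cat size_nseq absz_gt0 q0.
rewrite onth_nseq absz_gt0 q0.
by move=> [qp]; rewrite qp eqxx in pq.
Qed.

End RolliWeights.

(** * Cup products of weight sums with Brooks quasimorphisms, and the theorem *)

Lemma weight_cup_brooks (R : realType) n W (N : \bar R) (w : freeGroup n) :
  local_weight W -> N \is a fin_num -> touch_bounded W (2 * fine N) ->
  w <> 1%g ->
  cup_class (bclass (delta1 (weight_sum W))) (bclass (delta1 (brooks R w)))
    = bzero R (freeGroup n) 4 /\
  exists p : cochain R (freeGroup n) 3,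
    is_primitive p (cup (delta1 (weight_sum W)) (delta1 (brooks R w))) /\
    (supnorm p <= 6%:E * N * (defect (brooks R w) * (size w)%:R%:E))%E.
Proof.
move=> lW Nfin tW w1; have bw := @bounded_delta1_brooks R n w w1.
have Dfin : defect (brooks R w) \is a fin_num.
  rewrite ge0_fin_numE //; apply: le_trans (ler_supnorm _ [tuple 1%g; 1%g]).
  by rewrite lee_fin.
have wD t : `|delta1 (brooks R w) t| <= fine (defect (brooks R w)).
  by rewrite -lee_fin fineK // ler_supnorm.
have D0 : 0 <= fine (defect (brooks R w)) by apply: le_trans (wD [tuple 1%g; 1%g]).
have ple := cup_primitive_le lW tW wD.
have prim : is_primitive (cup_primitive W (brooks R w))
    (cup (delta1 (weight_sum W)) (delta1 (brooks R w))).
  by split; [apply/boundedP; eexists; exact: ple | exact: cup_primitiveP].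
split.
  apply: cup_class_delta1_eq0 prim => //.
  by apply/boundedP; eexists; exact: delta1_weight_sum_le lW tW.
exists (cup_primitive W (brooks R w)); split=> //; apply: supnorm_ler => t.
rewrite -(fineK Nfin) -(fineK Dfin) -!EFinM lee_fin.
(* The primitive is bounded by 6 times [N] times the defect; the factor [size w], at least 1, is
   then inserted. *)
apply: le_trans (ple t) _; rewrite (_ : 3 * (2 * _) = 6 * fine N); last by ring.
rewrite mulrA.
have N0 : 0 <= 6 * fine N * fine (defect (brooks R w)).
  have := le_trans (normr_ge0 _) (ple t); lra.
by rewrite ler_peMr // ler1n lt0n size_eq0; apply/eqP => e; apply: w1; apply: val_inj.
Qed.

Theorem corollary4p24 (R : realType) :
  exists K : R, 0 < K /\
  forall (n : nat) (Np : set (freeGroup n)) (alpha : freeGroup n -> R)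
         (lambda : 'I_n -> int -> R) (w : freeGroup n),
    (2 <= n)%N ->
    half_system Np ->
    l1Ind alpha ->
    (forall i, bounded (lambda i) /\ alternatingZ (lambda i)) ->
    w <> 1%g ->
    (cup_class (bclass (delta1 (brooks_sum Np alpha)))
               (bclass (delta1 (brooks R w))) = bzero R (freeGroup n) 4 /\
     exists p : cochain R (freeGroup n) 3,
       is_primitive p
         (cup (delta1 (brooks_sum Np alpha)) (delta1 (brooks R w))) /\
       (supnorm p <=
          K%:E * SInd alpha * (defect (brooks R w) * (size w)%:R%:E))%E)
    /\
    (cup_class (bclass (delta1 (rolli lambda)))
               (bclass (delta1 (brooks R w))) = bzero R (freeGroup n) 4 /\
     exists p : cochain R (freeGroup n) 3,
       is_primitive p
         (cup (delta1 (rolli lambda)) (delta1 (brooks R w))) /\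
       (supnorm p <=
          K%:E * rolli_norm lambda * (defect (brooks R w) * (size w)%:R%:E))%E).
Proof.
(* Three cuts at the center of the tripod, each with touching weights summing to at most twice the
   norm. *)
exists 6; split=> // n Np alpha lambda w _ hNp la llambda w1.
have alt i := (llambda i).2; have bl i := (llambda i).1.
have [alta supa _] := la; split.
  have -> : brooks_sum Np alpha = weight_sum (piece_weight alpha).
    by apply/funext => g; apply: brooks_sumE.
  apply: weight_cup_brooks => //; first exact: local_piece_weight.
    exact: SInd_fin.
  exact: touch_bounded_l1Ind.
have -> : rolli lambda = weight_sum (rolli_weight lambda).
  by apply/funext => g; apply: rolli_weight_sum.
apply: weight_cup_brooks => //; first exact: local_rolli_weight.
  exact: rolli_norm_fin.
exact: touch_bounded_rolli.
Qed.
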